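(* Let $H,K$ be complex Hilbert spaces, let $C_1,C_2\in\mathcal{L}(K,H)$, $D_1,D_2\in\mathcal{L}(H)$ and put $$\mathcal{D}_1=\{Z\in\mathcal{L}(H,K):(C_1Z+D_1)^{-1}\text{ exists}\},\qquad \mathcal{D}_2=\{Z\in\mathcal{L}(H,K):(C_2Z+D_2)^{-1}\text{ exists}\}.$$ Suppose there exists an invertible $R\in\mathcal{L}(K)$ with $C_2=C_1R$. Then for each $Z_1\in\mathcal{D}_1$ and $Z_2\in\mathcal{D}_2$ there is an invertible affine linear fractional transformation $\phi$ of $\mathcal{D}_1$ onto $\mathcal{D}_2$ with $\phi(Z_1)=Z_2$.
   Context: $\mathcal{L}(H,K)$ is the Banach space of bounded linear operators from $H$ to $K$, and $\mathcal{L}(H)=\mathcal{L}(H,H)$. ''$(CZ+D)^{-1}$ exists'' means that $CZ+D$ is invertible in $\mathcal{L}(H)$. An invertible affine linear fractional transformation is a map of the form $\phi(Z)=(PZ+Q)S^{-1}$ with $P\in\mathcal{L}(K)$ and $S\in\mathcal{L}(H)$ invertible and $Q\in\mathcal{L}(H,K)$. *)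

(* Defs.v *)
From HB Require Import structures.
From mathcomp Require Import all_boot all_order all_algebra.
From mathcomp Require Import all_classical all_reals all_analysis.
From mathcomp Require Import complex.

Set Implicit Arguments.
Unset Strict Implicit.
Unset Printing Implicit Defensive.

Import Order.TTheory GRing.Theory Num.Theory.
Import numFieldNormedType.Exports.

Local Open Scope classical_set_scope.
Local Open Scope ring_scope.
Local Open Scope complex_scope.

Reserved Notation "''L' ( H , K )" (format "''L' ( H ,  K )").
Reserved Notation "A \oL B" (at level 40, left associativity).

(* In a dot form the first argument is linear and the second conjugate-linear. *)
HB.mixin Record CompleteNormedModule_isHilbert (R : realType) H
    & CompleteNormedModule R[i] H := {
  inner : {dot H for Num.conj};
  normr_inner : forall x : H, `|x| ^+ 2 = inner x x
}.

#[short(type="hilbertType")]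
HB.structure Definition Hilbert (R : realType) :=
  {H of CompleteNormedModule R[i] H & CompleteNormedModule_isHilbert R H}.

Section BoundedOperators.
Context {R : realType}.
Implicit Types G H K : hilbertType R.

(* For linear f, boundedness near 0 is finiteness of the operator norm; see
   bounded_linearP. *)
Definition bounded_linear_pred H K : {pred H -> K} :=
  [pred f | `[< linear f /\ bounded_near f (nbhs (0 : H)) >]].

Lemma bounded_linearP H K (f : H -> K) :
  reflect (linear f /\ exists M : R[i], forall x, `|f x| <= M * `|x|)
    (f \in @bounded_linear_pred H K).
Proof.
apply: (iffP (asboolP _)) => -[lf bf]; split=> //.
  pose g : {linear H -> K} :=
    HB.pack f (GRing.isLinear.Build R[i] H K *:%R f lf).
  have /(linear_boundedP g) bg := bf.
  by apply: filter_ex bg.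
pose g : {linear H -> K} :=
  HB.pack f (GRing.isLinear.Build R[i] H K *:%R f lf).
case: bf => M fM; apply/(@bounded_funP _ _ _ g) => r.
exists (`|M| * r) => x xr; apply: (@le_trans _ _ (`|M| * `|x|)).
  have M0 : 0 <= M * `|x| by rewrite (le_trans _ (fM x)).
  by rewrite (le_trans (fM x))// -(ger0_norm M0) normrM normr_id.
by rewrite ler_wpM2l.
Qed.

Lemma bounded_linear_submod H K : submod_closed (@bounded_linear_pred H K).
Proof.
split.
  apply/bounded_linearP; split; last first.
    by exists 0 => x; rewrite mul0r normr0.
  by move=> a x y /=; rewrite scaler0 addr0.
move=> a f g /bounded_linearP[lf [M fM]] /bounded_linearP[lg [N gN]].
apply/bounded_linearP; split.
  move=> b x y; rewrite !fctE lf lg !scalerDr !scalerA addrACA.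
  by rewrite [b * a]mulrC.
exists (`|a| * M + N) => x; rewrite !fctE (le_trans (ler_normD _ _))//.
by rewrite mulrDl lerD// normrZ -mulrA ler_wpM2l.
Qed.

HB.instance Definition _ H K := GRing.isSubmodClosed.Build R[i] (H -> K)
  (@bounded_linear_pred H K) (bounded_linear_submod H K).

Record bounded_op H K := BoundedOp {
  bounded_op_fun :> H -> K;
  bounded_op_subproof : bounded_op_fun \in @bounded_linear_pred H K
}.

HB.instance Definition _ H K := [isSub for @bounded_op_fun H K].
HB.instance Definition _ H K := [Choice of bounded_op H K by <:].
HB.instance Definition _ H K :=
  [SubChoice_isSubLmodule of bounded_op H K by <:].

Lemma bounded_op_linear H K (A : bounded_op H K) : linear A.
Proof. by have /bounded_linearP[] := bounded_op_subproof A. Qed.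

HB.instance Definition _ H K (A : bounded_op H K) :=
  GRing.isLinear.Build R[i] H K *:%R A (bounded_op_linear A).

End BoundedOperators.

Notation "''L' ( H , K )" := (bounded_op H K) : type_scope.

Section BoundedOperatorAlgebra.
Context {R : realType}.
Implicit Types G H K : hilbertType R.

Lemma comp_op_subproof G H K (A : 'L(H, K)) (B : 'L(G, H)) :
  A \o B \in @bounded_linear_pred R G K.
Proof.
have /bounded_linearP[lA [M AM]] := bounded_op_subproof A.
have /bounded_linearP[lB [N BN]] := bounded_op_subproof B.
apply/bounded_linearP; split; first by move=> a x y /=; rewrite lB lA.
exists (`|M| * N) => x /=; rewrite -mulrA.
apply: (@le_trans _ _ (`|M| * `|B x|)); last by rewrite ler_wpM2l.
have M0 : 0 <= M * `|B x| by rewrite (le_trans _ (AM _)).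
by rewrite (le_trans (AM _))// -(ger0_norm M0) normrM normr_id.
Qed.

Definition comp_op G H K (A : 'L(H, K)) (B : 'L(G, H)) : 'L(G, K) :=
  BoundedOp (comp_op_subproof A B).

Lemma id_op_subproof H : idfun \in @bounded_linear_pred R H H.
Proof. by apply/bounded_linearP; split=> //; exists 1 => x; rewrite mul1r. Qed.

Definition id_op H : 'L(H, H) := BoundedOp (id_op_subproof H).

End BoundedOperatorAlgebra.

Notation "A \oL B" := (comp_op A B) : ring_scope.

Section LinearFractional.
Context {R : realType}.
Implicit Types H K : hilbertType R.

Definition is_inverse H (A B : 'L(H, H)) :=
  A \oL B = id_op H /\ B \oL A = id_op H.

Definition invertible H (A : 'L(H, H)) := exists B, is_inverse A B.

(* Equal to A itself when A is not invertible. *)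
Definition inv_op H (A : 'L(H, H)) : 'L(H, H) := xget A [set B | is_inverse A B].

Lemma inv_opP H (A : 'L(H, H)) : invertible A -> is_inverse A (inv_op A).
Proof. by move=> [B AB]; apply: (xgetPex A); exists B. Qed.

Definition lft_domain H K (C : 'L(K, H)) (D : 'L(H, H)) : set 'L(H, K) :=
  [set Z | invertible (C \oL Z + D)].

Definition invertible_affine_lft H K (phi : 'L(H, K) -> 'L(H, K)) :=
  exists (P : 'L(K, K)) (Q : 'L(H, K)) (S : 'L(H, H)),
    [/\ invertible P, invertible S &
        forall Z, phi Z = (P \oL Z + Q) \oL inv_op S].

End LinearFractional.

(* Main.v *)
Require Import Defs.
From HB Require Import structures.
From mathcomp Require Import all_boot all_order all_algebra.
From mathcomp Require Import all_classical all_reals all_analysis.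
From mathcomp Require Import complex.

Import GRing.Theory.

Local Open Scope classical_set_scope.
Local Open Scope ring_scope.

(** Write [M1 = C1 Z1 + D1], [M2 = C2 Z2 + D2] and [C2 = C1 T]. Both [M1] and
    [M2] are invertible, hence so is [S = M2^-1 M1]. The map
      [phi(Z) = Z2 + T^-1 (Z - Z1) S^-1]
    is affine and sends [Z1] to [Z2]. The factor [T^-1] turns [C2] into [C1],
    and [S] is chosen so that [M2 S = M1]; therefore
      [(C2 phi(Z) + D2) S = M2 S + C1 (Z - Z1) = C1 Z + D1]
    ([affine_lft_intertwine]). As [S] is invertible, [phi(Z)] lies in the second
    domain exactly when [Z] lies in the first. Since [phi] is a bijection of the
    whole space of operators ([affine_lft_surj]), it maps the first domain onto
    the second. *)

Section BoundedOperatorArithmetic.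
Local Set Implicit Arguments.
Local Unset Strict Implicit.
Context {R : realType}.
Implicit Types F G H K : hilbertType R.

Lemma bounded_op_ext H K (A B : 'L(H, K)) : A =1 B -> A = B.
Proof. by move=> AB; apply: val_inj; apply/funext. Qed.

Lemma comp_opA F G H K (A : 'L(H, K)) (B : 'L(G, H)) (C : 'L(F, G)) :
  A \oL (B \oL C) = A \oL B \oL C.
Proof. exact: bounded_op_ext. Qed.

Lemma comp_op1 H K (A : 'L(H, K)) : A \oL id_op H = A.
Proof. exact: bounded_op_ext. Qed.

Lemma comp_1op H K (A : 'L(H, K)) : id_op K \oL A = A.
Proof. exact: bounded_op_ext. Qed.

Lemma comp_opDl G H K (A B : 'L(H, K)) (C : 'L(G, H)) :
  (A + B) \oL C = A \oL C + B \oL C.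
Proof. exact: bounded_op_ext. Qed.

Lemma comp_opDr G H K (A : 'L(H, K)) (B C : 'L(G, H)) :
  A \oL (B + C) = A \oL B + A \oL C.
Proof. by apply: bounded_op_ext => x; exact: (raddfD A). Qed.

Lemma comp_opBr G H K (A : 'L(H, K)) (B C : 'L(G, H)) :
  A \oL (B - C) = A \oL B - A \oL C.
Proof. by apply: bounded_op_ext => x; exact: (raddfB A). Qed.

Lemma is_inverse_sym H (A B : 'L(H, H)) : is_inverse A B -> is_inverse B A.
Proof. by case. Qed.

Lemma invertible_inv H (A : 'L(H, H)) : invertible A -> invertible (inv_op A).
Proof. by move=> /inv_opP/is_inverse_sym ?; exists A. Qed.

Lemma invertible_comp H (A B : 'L(H, H)) :
  invertible A -> invertible B -> invertible (A \oL B).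
Proof.
move=> [A' [AA' A'A]] [B' [BB' B'B]]; exists (B' \oL A'); split.
  by rewrite comp_opA -(comp_opA A) BB' comp_op1.
by rewrite comp_opA -(comp_opA B') A'A comp_op1.
Qed.

Lemma comp_opK G H (S : 'L(G, G)) (A : 'L(G, H)) :
  invertible S -> A \oL S \oL inv_op S = A.
Proof. by move=> /inv_opP[SV _]; rewrite -comp_opA SV comp_op1. Qed.

Lemma comp_opVK G H (S : 'L(G, G)) (A : 'L(G, H)) :
  invertible S -> A \oL inv_op S \oL S = A.
Proof. by move=> /inv_opP[_ VS]; rewrite -comp_opA VS comp_op1. Qed.

Lemma invertible_compr H (A S : 'L(H, H)) :
  invertible S -> invertible (A \oL S) <-> invertible A.
Proof.
move=> iS; split=> [iAS|iA]; last exact: invertible_comp.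
by rewrite -(comp_opK A iS); apply/invertible_comp/invertible_inv.
Qed.

Lemma affine_lft_surj H K (P : 'L(K, K)) (Q : 'L(H, K)) (S : 'L(H, H)) :
  invertible P -> invertible S ->
  forall W, exists Z, (P \oL Z + Q) \oL inv_op S = W.
Proof.
move=> /inv_opP[PV _] iS W; exists (inv_op P \oL (W \oL S - Q)).
by rewrite comp_opA PV comp_1op subrK comp_opK.
Qed.

(** The constant term [Z2 S - P Z1] makes the map send [Z1] to [Z2], while the
    hypothesis on [S] matches the two denominators at these base points; by
    linearity they then match, up to the factor [S], at every [Z]. *)
Lemma affine_lft_intertwine H K (C1 C2 : 'L(K, H)) (D1 D2 : 'L(H, H))
    (P : 'L(K, K)) (S : 'L(H, H)) (Z1 Z2 Z : 'L(H, K)) :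
  invertible S -> C2 \oL P = C1 ->
  (C2 \oL Z2 + D2) \oL S = C1 \oL Z1 + D1 ->
  (C2 \oL ((P \oL Z + (Z2 \oL S - P \oL Z1)) \oL inv_op S) + D2) \oL S
    = C1 \oL Z + D1.
Proof.
move=> iS CP MS; rewrite comp_opDl -comp_opA comp_opVK//.
rewrite comp_opDr comp_opBr !comp_opA CP.
rewrite comp_opDl in MS.
by rewrite -addrA addrAC MS [C1 \oL Z1 + D1]addrC addrK addrC.
Qed.

End BoundedOperatorArithmetic.

Theorem proposition5 (R : realType) (H K : hilbertType R)
    (C1 C2 : 'L(K, H)) (D1 D2 : 'L(H, H))
    (hC : exists T : 'L(K, K), invertible T /\ C2 = C1 \oL T)
    (Z1 Z2 : 'L(H, K))
    (hZ1 : lft_domain C1 D1 Z1) (hZ2 : lft_domain C2 D2 Z2) :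
  exists phi : 'L(H, K) -> 'L(H, K),
    [/\ invertible_affine_lft phi,
        phi @` lft_domain C1 D1 = lft_domain C2 D2 &
        phi Z1 = Z2].
Proof.
case: hC => T [iT C2E].
pose P := inv_op T.
pose S := inv_op (C2 \oL Z2 + D2) \oL (C1 \oL Z1 + D1).
pose Q := Z2 \oL S - P \oL Z1.
have iP : invertible P by exact: invertible_inv.
have iS : invertible S by apply: invertible_comp => //; exact: invertible_inv.
have CP : C2 \oL P = C1 by rewrite C2E comp_opK.
have MS : (C2 \oL Z2 + D2) \oL S = C1 \oL Z1 + D1.
  by rewrite comp_opA (inv_opP hZ2).1 comp_1op.
pose phi Z := (P \oL Z + Q) \oL inv_op S.
have phi_dom Z : lft_domain C2 D2 (phi Z) <-> lft_domain C1 D1 Z.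
  rewrite /lft_domain /= -(affine_lft_intertwine Z iS CP MS).
  by split=> /(invertible_compr _ iS).
exists phi; split.
- by exists P, Q, S.
- apply/seteqP; split=> [_ [Z Z_dom <-]|W W_dom]; first exact/phi_dom.
  have [Z phiZ] := affine_lft_surj Q iP iS W.
  by exists Z => //; apply/phi_dom; rewrite /phi phiZ.
- by rewrite /phi /Q addrC subrK comp_opK.
Qed.
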